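(* Let $m\ge 2$, let $A\leqslant \mathcal{A}_m$ be a self-similar abelian group, and let $\Delta=\langle x_1,\dots,x_s\rangle$ be the monoid of partial diagonal monomorphisms associated with the orbits of $A$ on the first level. Define $A^*=C_{\mathcal{A}_m}(\Delta(A))$, the centralizer of $\Delta(A)$ in $\mathcal{A}_m$. Then: (i) $\Delta(A)$, $\Delta(B(A))$ and $\overline{\Delta(B(A))}$ are again self-similar abelian groups and of the same permutation-type as $A$; (ii) $A^*$ is a maximal abelian subgroup of $\mathcal{A}_m$; (iii) $A^*=\overline{\Delta(B(A))}$.
   Context: Tree automorphisms. $Y=\{1,\dots,m\}$, $\mathcal{T}_m$ is the rooted $m$-ary tree whose vertices are the finite words over $Y$ (root the empty word, edges $(u,uy)$ with $y\in Y$), and $\mathcal{A}_m$ is its automorphism group, acting on the right. Each $\alpha\in\mathcal{A}_m$ is written $\alpha=(\alpha_1,\dots,\alpha_m)\sigma(\alpha)$, where $\sigma(\alpha)\in Sym(Y)$ is the permutation induced on the first level (the activity of $\alpha$), $\alpha_y\in\mathcal{A}_m$, and $(y_1y_2\cdots y_n)^{\alpha}=(y_1)^{\sigma(\alpha)}(y_2\cdots y_n)^{\alpha_{y_1}}$. The set of states of $\alpha$ is defined recursively by $Q(\alpha)=\{\alpha\}\cup\bigcup_{i}Q(\alpha_i)$. A subgroup $G\leqslant\mathcal{A}_m$ is self-similar if $Q(\alpha)\subseteq G$ for all $\alpha\in G$. The identity is $e$. $\mathcal{A}_m$ is a topological group in which the pointwise stabilizers of the levels form a basis of neighbourhoods of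 $e$; a bar denotes topological closure. Orbits. For $G\leqslant\mathcal{A}_m$, $P(G)\leqslant Sym(m)$ is the group of activities of elements of $G$. Its orbits on $Y$ are $O_{(1)}=\{1,\dots,m_1\}$, $O_{(2)}=\{m_1+1,\dots,m_1+m_2\}$, $\dots$, $O_{(s)}=\{m_1+\dots+m_{s-1}+1,\dots,m\}$, of sizes $m_1,\dots,m_s$ ($s\ge1$). $P_{(i)}$ is the transitive group induced by $P(G)$ on $O_{(i)}$ (viewed as a permutation group on $Y$ fixing the other points); $(P_{(1)},\dots,P_{(s)})$ is the permutation-type of $G$. Each $\sigma\in P(G)$ decomposes as $\sigma=\sigma_{(1)}\cdots\sigma_{(s)}$ with $\sigma_{(i)}\in P_{(i)}$. $B(G)$. For $\alpha=(\alpha_1,\dots,\alpha_m)\sigma\in G$, let $\alpha_{[i]}\in\mathcal{A}_m$ be the automorphism with activity $\sigma_{(i)}$, with first-level state $\alpha_y$ at each $y\in O_{(i)}$ and $e$ at each $y\notin O_{(i)}$. Put $G_{[i]}=\{\alpha_{[i]}\mid\alpha\in G\}$ and $B(G)=G_{[1]}\cdots G_{[s]}$ (a direct product). $\Delta$. For $1\le i\le s$, $x_i:\mathcal{A}_m\to\mathcal{A}_m$ sends $\alpha$ to the automorphism with trivial activity having $\alpha$ in every coordinate from $O_{(i)}$ and $e$ in all other coordinates. The orbits used here are those of $A$. $\Delta=\langle x_1,\dots,x_s\rangle$ is the monoid generated under composition (maps written on the right as exponents), and for a subgroup $H$, $\Delta(H)=\langle H^{\omega}\mid\omega\in\Delt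a\rangle$.
   Formalization: Parts (ii) and (iii) are stated for A ≠ {e} only: for A = {e} one has Δ(A) = Δ(B(A)) = {e}, so A^* is all of 𝒜_m, which is non-abelian and not equal to the closure {e}; part (i) is stated for every A. *)

(* Defs.v *)
From HB Require Import structures.
From mathcomp Require Import all_boot all_fingroup.
From mathcomp Require Import boolp classical_sets filter topology.

Set Implicit Arguments.
Unset Strict Implicit.
Unset Printing Implicit Defensive.

Local Open Scope classical_set_scope.
Local Open Scope group_scope.

(** The rooted [m]-ary tree: vertices are words over ['I_m], and the edges
    are the pairs [(u, u y)], written [(u, rcons u y)]. *)
Definition edge m (u v : seq 'I_m) : bool := [exists y, v == rcons u y].

Definition is_tree_aut m (f : seq 'I_m -> seq 'I_m) : Prop :=
  [/\ bijective f, f [::] = [::] & forall u v, edge (f u) (f v) = edge u v].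

Record tree_aut m :=
  TreeAut { tfun :> seq 'I_m -> seq 'I_m; tfunP : is_tree_aut tfun }.

HB.instance Definition _ m := gen_eqMixin (tree_aut m).
HB.instance Definition _ m := gen_choiceMixin (tree_aut m).

Lemma tree_autP m (a b : tree_aut m) : (forall w, a w = b w) -> a = b.
Proof.
case: a b => [f fP] [g gP] /= fg.
have E : f = g by apply: funext.
by case: _ / E gP => gP; congr TreeAut; apply: Prop_irrelevance.
Qed.

Section TreeAutGroup.
Context {m : nat}.
Implicit Types (a b : tree_aut m) (u v w : seq 'I_m) (y : 'I_m).

Lemma tree_aut_nil a : a [::] = [::]. Proof. by case: (tfunP a). Qed.

Lemma tree_aut_edge a u v : edge (a u) (a v) = edge u v.
Proof. by case: (tfunP a). Qed.

Lemma id_tree_aut : is_tree_aut (@id (seq 'I_m)).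
Proof. by split => //; exists id. Qed.

Lemma comp_tree_aut a b : is_tree_aut (b \o a).
Proof.
split=> [||u v /=]; last by rewrite !tree_aut_edge.
- by apply: bij_comp; [case: (tfunP b) | case: (tfunP a)].
- by rewrite /= !tree_aut_nil.
Qed.

Lemma tree_aut_inverse a : exists g, cancel a g /\ cancel g a.
Proof. by case: (tfunP a) => [[g ag ga] _ _]; exists g. Qed.

Definition tree_aut_inv_fun a := projT1 (cid (tree_aut_inverse a)).

Lemma tree_aut_invK a : cancel a (tree_aut_inv_fun a).
Proof. by rewrite /tree_aut_inv_fun; case: cid => g []. Qed.

Lemma tree_autK a : cancel (tree_aut_inv_fun a) a.
Proof. by rewrite /tree_aut_inv_fun; case: cid => g []. Qed.

Lemma inv_tree_aut a : is_tree_aut (tree_aut_inv_fun a).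
Proof.
split=> [||u v].
- by exists a; [apply: tree_autK | apply: tree_aut_invK].
- by rewrite -[X in _ X = _](tree_aut_nil a) tree_aut_invK.
- by rewrite -(tree_aut_edge a) !tree_autK.
Qed.

(** Automorphisms act on the right: [(a * b) w = b (a w)], as for the
    permutations in ['S_m]. *)
Definition tree_aut_one : tree_aut m := TreeAut id_tree_aut.
Definition tree_aut_mul a b : tree_aut m := TreeAut (comp_tree_aut a b).
Definition tree_aut_inv a : tree_aut m := TreeAut (inv_tree_aut a).

Lemma tree_aut_mulA : associative tree_aut_mul.
Proof. by move=> a b c; apply: tree_autP. Qed.
Lemma tree_aut_mul1 : left_id tree_aut_one tree_aut_mul.
Proof. by move=> a; apply: tree_autP. Qed.
Lemma tree_aut_mulr1 : right_id tree_aut_one tree_aut_mul.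
Proof. by move=> a; apply: tree_autP. Qed.
Lemma tree_aut_mulV : left_inverse tree_aut_one tree_aut_inv tree_aut_mul.
Proof. by move=> a; apply: tree_autP => w /=; rewrite tree_autK. Qed.
Lemma tree_aut_mulrV : right_inverse tree_aut_one tree_aut_inv tree_aut_mul.
Proof. by move=> a; apply: tree_autP => w /=; rewrite tree_aut_invK. Qed.

End TreeAutGroup.

HB.instance Definition _ m := isGroup.Build (tree_aut m) (@tree_aut_mulA m)
  (@tree_aut_mul1 m) (@tree_aut_mulr1 m) (@tree_aut_mulV m)
  (@tree_aut_mulrV m).

Lemma tree_autM m (a b : tree_aut m) w : (a * b) w = b (a w).
Proof. by []. Qed.

Lemma tree_aut1 m w : (1 : tree_aut m) w = w.
Proof. by []. Qed.

(** Pointwise stabilizer of the [n]-th level; the left cosets of these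
    subgroups are the basic neighbourhoods. *)
Definition level_stab m (n : nat) : set (tree_aut m) :=
  [set a | forall w, size w = n -> a w = w].

Definition tree_aut_nbhs m (a : tree_aut m) : set_system (tree_aut m) :=
  filter_from [set: nat] (fun n => [set a * s | s in level_stab n]).

HB.instance Definition _ m := hasNbhs.Build (tree_aut m) (@tree_aut_nbhs m).

Section TreeAutStates.
Context {m : nat}.
Implicit Types (a b : tree_aut m) (u v w : seq 'I_m) (y z : 'I_m).

Lemma edge_nil v : edge [::] v = (size v == 1)%N.
Proof.
apply/existsP/idP => [[y /eqP ->] //|].
by case: v => [|y []] // _; exists y.
Qed.

Lemma edge_cons y z u v : edge (y :: u) (z :: v) = (y == z) && edge u v.
Proof.
apply/existsP/andP => [[x /eqP [-> ->]]|[/eqP -> /existsP [x /eqP ->]]].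
  by split=> //; apply/existsP; exists x.
by exists x.
Qed.

Lemma edge_cons_nil y u : edge (y :: u) [::] = false.
Proof. by apply/existsP => -[]. Qed.

Lemma tree_aut_rcons a u y : exists z, a (rcons u y) = rcons (a u) z.
Proof.
have : edge (a u) (a (rcons u y)).
  by rewrite tree_aut_edge; apply/existsP; exists y.
by case/existsP => z /eqP; exists z.
Qed.

Lemma size_tree_aut a w : size (a w) = size w.
Proof.
elim/last_ind: w => [|w y IH]; first by rewrite tree_aut_nil.
by have [z ->] := tree_aut_rcons a w y; rewrite !size_rcons IH.
Qed.

Definition activity_fun a y := head y (a [:: y]).

Definition state_fun a y w := behead (a (y :: w)).

Lemma tree_aut_cons_fun a y w :
  a (y :: w) = activity_fun a y :: state_fun a y w.
Proof.
rewrite /state_fun; elim/last_ind: w => [|w z IH].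
  rewrite /activity_fun; have := size_tree_aut a [:: y].
  by case: (a [:: y]).
have [x E] := tree_aut_rcons a (y :: w) z.
by move: E; rewrite rcons_cons => ->; rewrite IH.
Qed.

Lemma activity_fun_invK a y :
  activity_fun a^-1 (activity_fun a y) = y.
Proof.
have E : a [:: y] = [:: activity_fun a y].
  rewrite tree_aut_cons_fun; congr cons.
  by apply: size0nil; rewrite size_behead size_tree_aut.
by rewrite {1}/activity_fun -E -[X in head _ X]/(tree_aut_inv_fun a _)
           tree_aut_invK.
Qed.

Lemma activity_fun_inj a : injective (activity_fun a).
Proof. exact: can_inj (activity_fun_invK a). Qed.

(** [activity a] is the permutation induced on the first level, and
    [state a y] the state [a_y]; see [tree_aut_cons]. *)
Definition activity a : 'S_m := perm (@activity_fun_inj a).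

Lemma state_is_tree_aut a y : is_tree_aut (state_fun a y).
Proof.
have E (u v : seq 'I_m) : behead (y :: u) = behead (y :: v) -> u = v by [].
split=> [||u v].
- exists (state_fun a^-1 (activity_fun a y)) => w.
    rewrite {1}/state_fun -tree_aut_cons_fun.
    by rewrite -[X in behead X]/(tree_aut_inv_fun a _) tree_aut_invK.
  rewrite {1}/state_fun.
  rewrite -{1}[y](activity_fun_invK a) -tree_aut_cons_fun.
  by rewrite -[X in a X]/(tree_aut_inv_fun a _) tree_autK.
- by apply: size0nil; rewrite size_behead size_tree_aut.
- have := tree_aut_edge a (y :: u) (y :: v).
  by rewrite !tree_aut_cons_fun !edge_cons !eqxx.
Qed.

Definition state a y : tree_aut m := TreeAut (state_is_tree_aut a y).

Lemma tree_aut_cons a y w : a (y :: w) = activity a y :: state a y w.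
Proof. by rewrite permE /= tree_aut_cons_fun. Qed.

Definition wreath_fun (s : 'S_m) (f : 'I_m -> tree_aut m) w : seq 'I_m :=
  if w is y :: u then s y :: f y u else [::].

Lemma wreath_is_tree_aut s f : is_tree_aut (wreath_fun s f).
Proof.
split=> // [|[|y u] [|z v] /=].
- exists (wreath_fun s^-1 (fun y => (f (s^-1 y))^-1)) => -[|y u] //=.
    by rewrite permK -/(tfun (tree_aut_inv _)) tree_aut_invK.
  by rewrite permKV -[X in f _ X]/(tree_aut_inv_fun _ _) tree_autK.
- by rewrite !edge_nil.
- by rewrite !edge_nil /= size_tree_aut.
- by rewrite !edge_cons_nil.
- rewrite !edge_cons (inj_eq perm_inj); case: eqP => //= ->.
  exact: tree_aut_edge.
Qed.

(** [wreath s f] is the automorphism [(f 1, ..., f m) s]. *)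
Definition wreath s f : tree_aut m := TreeAut (wreath_is_tree_aut s f).

End TreeAutStates.

Section TreeAutTopology.
Context {m : nat}.
Implicit Types a : tree_aut m.

Lemma level_stab_le n k : (n <= k)%N ->
  @level_stab m k `<=` @level_stab m n.
Proof.
case: m => [|m'] nk a ak w wn.
  by case: w wn => [|[]//]; rewrite tree_aut_nil.
have := ak (w ++ nseq (k - n) ord0).
rewrite size_cat size_nseq wn subnKC // => /(_ erefl).
have pre (u v : seq 'I_m'.+1) : take (size u) (a (u ++ v)) = a u.
  elim/last_ind: v => [|v z IH].
    by rewrite cats0 -(size_tree_aut a) take_size.
  rewrite -rcons_cat; have [x ->] := tree_aut_rcons a (u ++ v) z.
  by rewrite -cats1 takel_cat ?IH // size_tree_aut size_cat leq_addr.
by move=> /(congr1 (take (size w))); rewrite pre take_size_cat.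
Qed.

Lemma level_stabM n (a b : tree_aut m) :
  level_stab n a -> level_stab n b -> level_stab n (a * b).
Proof. by move=> an bn w wn; rewrite tree_autM an // bn. Qed.

Lemma level_stab1 n : level_stab n (1 : tree_aut m).
Proof. by []. Qed.

Lemma tree_aut_nbhs_filter a : ProperFilter (nbhs a).
Proof.
apply: filter_from_proper => [|n _]; last by exists (a * 1), 1.
apply: filter_from_filter => [|i j _ _]; first by exists 0%N.
exists (maxn i j) => // _ [s sij <-]; split; exists s => //.
  exact: level_stab_le (leq_maxl i j) _ sij.
exact: level_stab_le (leq_maxr i j) _ sij.
Qed.

Lemma tree_aut_nbhs_singleton a (B : set (tree_aut m)) : nbhs a B -> B a.
Proof. by case=> n _; apply; exists 1; rewrite ?mulg1. Qed.

Lemma tree_aut_nbhs_nbhs a (B : set (tree_aut m)) :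
  nbhs a B -> nbhs a (nbhs^~ B).
Proof.
case=> n _ aB; exists n => // _ [s sn <-]; exists n => // _ [t tn <-].
by apply: aB; exists (s * t); rewrite ?mulgA //; apply: level_stabM.
Qed.

End TreeAutTopology.

HB.instance Definition _ m := Nbhs_isNbhsTopological.Build (tree_aut m)
  (@tree_aut_nbhs_filter m) (@tree_aut_nbhs_singleton m)
  (@tree_aut_nbhs_nbhs m).

Definition is_subgroup (gT : groupType) (G : set gT) : Prop :=
  [/\ G 1, forall x y, G x -> G y -> G (x * y) & forall x, G x -> G x^-1].

Definition is_abelian (gT : groupType) (G : set gT) : Prop :=
  forall x y, G x -> G y -> commute x y.

Definition generated_subgroup (gT : groupType) (X : set gT) : set gT :=
  smallest (@is_subgroup gT) X.

Definition centralizer_of (gT : groupType) (X : set gT) : set gT :=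
  [set g | forall x, X x -> commute g x].

Definition maximal_abelian_subgroup (gT : groupType) (G : set gT) : Prop :=
  [/\ is_subgroup G, is_abelian G &
      forall K : set gT, is_subgroup K -> is_abelian K -> G `<=` K -> K = G].

Inductive states_of m : tree_aut m -> set (tree_aut m) :=
| states_self a : states_of a a
| states_step a y b : states_of (state a y) b -> states_of a b.

Definition self_similar m (G : set (tree_aut m)) : Prop :=
  is_subgroup G /\ forall a, G a -> states_of a `<=` G.

Definition activities m (G : set (tree_aut m)) : {set 'S_m} :=
  [set s | `[< exists2 a, G a & activity a = s >]]%SET.

(** The orbits of [P(G)] on ['I_m], each listed once.  As [undup] keeps last
    occurrences they are sorted by largest element; when the orbits are
    consecutive intervals this is their left-to-right order. *)
Definition orbits m (G : set (tree_aut m)) : seq {set 'I_m} :=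
  undup [seq orbit 'P%act (activities G) y | y <- enum 'I_m].

(** [restr_perm Oi s] is [s] on [Oi] and the identity off [Oi]; thus the [i]-th
    entry of the permutation type is the group [P_(i)], acting on ['I_m]. *)
Definition permutation_type m (G : set (tree_aut m)) : seq {set 'S_m} :=
  [seq [set restr_perm Oi s | s in activities G]%SET | Oi <- orbits G].

(** The automorphism [a_[i]] attached to the orbit [Oi = O_(i)]. *)
Definition orbit_part m (Oi : {set 'I_m}) (a : tree_aut m) : tree_aut m :=
  wreath (restr_perm Oi (activity a))
         (fun y => if y \in Oi then state a y else 1).

(** [B(G)], the product [G_[1] ... G_[s]] over the orbits of [G]. *)
Definition orbit_product m (G : set (tree_aut m)) : set (tree_aut m) :=
  let s := size (orbits G) in
  let part (i : 'I_s) : set (tree_aut m) :=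
    [set orbit_part (nth finset.set0 (orbits G) i) a | a in G] in
  [set \prod_(i < s) g i | g in [set g : 'I_s -> tree_aut m |
                                  forall i, part i (g i)]].

(** The partial diagonal map [x_i] attached to the orbit [Oi = O_(i)]. *)
Definition partial_diag m (Oi : {set 'I_m}) (a : tree_aut m) : tree_aut m :=
  wreath 1 (fun y => if y \in Oi then a else 1).

(** [diag_monoid A] is the monoid generated under composition by the partial
    diagonal maps of the orbits of [A]. *)
Definition diag_monoid m (A : set (tree_aut m)) :
    set (tree_aut m -> tree_aut m) :=
  smallest [set M | M id /\ forall f g, M f -> M g -> M (g \o f)]
           [set partial_diag Oi | Oi in [set` orbits A]].

(** [Delta(H)] for the monoid [Delta] of [A]. *)
Definition diag_closure m (A H : set (tree_aut m)) : set (tree_aut m) :=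
  generated_subgroup [set w h | w in diag_monoid A & h in H].

(* Main.v *)
Require Import Defs.
From mathcomp Require Import all_boot all_fingroup.
From mathcomp Require Import boolp classical_sets filter topology.

Set Implicit Arguments.
Unset Strict Implicit.
Unset Printing Implicit Defensive.

Local Open Scope classical_set_scope.
Local Open Scope group_scope.

(** A transitive abelian permutation group is its own centralizer.  If [g]
    centralizes [Delta(A)] and [1 <> a \in A], then commuting with the [x_i(a)]
    forces [g] to preserve each orbit, and commuting with [A] makes [g] act on
    each orbit like an element of [A]; hence [g = b d] with [b \in B(A)] and [d]
    of trivial activity.  Commuting with the [x_i(Delta(A))] puts the states of
    [d] in [A^*], and commuting with [A] makes them constant on each orbit, so
    [d] is the product of the [x_i(d_i)] with [d_i \in A^*].  Iterating on the
    [d_i] approximates [g] by elements of [Delta(B(A))] at every level. *)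

(** * Generated subgroups and centralizers *)

Section GeneratedSubgroup.
Context {gT : groupType}.
Implicit Types (X G : set gT).

Lemma sub_generated X : X `<=` generated_subgroup X.
Proof. by move=> x Xx G [_]; apply. Qed.

Lemma generated_sub X G : is_subgroup G -> X `<=` G ->
  generated_subgroup X `<=` G.
Proof. by move=> gG XG x; apply. Qed.

Lemma generated_is_subgroup X : is_subgroup (generated_subgroup X).
Proof.
split=> [G [[]]//|x y gx gy G GX|x gx G GX]; case: (GX) => -[_ GM GV] _.
  by apply: GM; [apply: gx | apply: gy].
by apply: GV; apply: gx.
Qed.

Lemma centralizer_is_subgroup X : is_subgroup (centralizer_of X).
Proof.
split=> [x _|x y cx cy z Xz|x cx z Xz]; first exact/commute_sym/commute1.
- by apply/commute_sym/commuteM; apply/commute_sym; [apply: cx | apply: cy].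
- by apply/commute_sym/commuteV/commute_sym/cx.
Qed.

(** Centralizers are subgroups, so the argument runs twice: [X] centralizes [X], hence the generated
    subgroup centralizes [X], hence [X], and with it the generated subgroup, centralizes the
    generated subgroup. *)
Lemma generated_abelian X : is_abelian X -> is_abelian (generated_subgroup X).
Proof.
move=> cX; have cgX : generated_subgroup X `<=` centralizer_of X.
  apply: generated_sub => [|x Xx y Xy].
    exact: centralizer_is_subgroup.
  exact: cX.
move=> x y gx gy.
have : generated_subgroup X `<=` centralizer_of (generated_subgroup X).
  apply: generated_sub => [|z Xz t gt]; first exact: centralizer_is_subgroup.
  exact/commute_sym/cgX.
exact.
Qed.

Lemma subgroup_prod G (I : eqType) (r : seq I) (g : I -> gT) : is_subgroup G ->
  {in r, forall i, G (g i)} -> G (\prod_(i <- r) g i).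
Proof.
by case=> G1 GM _ Gg; rewrite big_seq; apply: (big_ind G).
Qed.

End GeneratedSubgroup.

(** * Wreath recursion and products with disjoint supports *)

Section WreathRecursion.
Context {m : nat}.
Implicit Types (a b : tree_aut m) (G X : set (tree_aut m)) (y z : 'I_m).

Lemma activity_state a b y y' :
  (forall w, a (y :: w) = b (y' :: w)) <->
  activity a y = activity b y' /\ state a y = state b y'.
Proof.
split=> [E|[E1 E2] w]; last by rewrite !tree_aut_cons E1 E2.
have E1 w : activity a y :: state a y w = activity b y' :: state b y' w.
  by rewrite -!tree_aut_cons.
by split; [case: (E1 [::]) | apply: tree_autP => w; case: (E1 w)].
Qed.

Lemma activityM a b y : activity (a * b) y = activity b (activity a y).
Proof.
have : (a * b) [:: y] = b (a [:: y]) by [].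
by rewrite !tree_aut_cons => -[].
Qed.

Lemma stateM a b y : state (a * b) y = state a y * state b (activity a y).
Proof.
apply: tree_autP => w; have : (a * b) (y :: w) = b (a (y :: w)) by [].
by rewrite !tree_aut_cons => -[].
Qed.

Lemma activity1 y : activity (1 : tree_aut m) y = y.
Proof.
by have : (1 : tree_aut m) [:: y] = [:: y] by []; rewrite tree_aut_cons => -[].
Qed.

Lemma state1 y : state (1 : tree_aut m) y = 1.
Proof.
apply: tree_autP => w.
by have : (1 : tree_aut m) (y :: w) = y :: w by []; rewrite tree_aut_cons => -[].
Qed.

Lemma activityV a y : activity a^-1 (activity a y) = y.
Proof. by rewrite -activityM mulgV activity1. Qed.

Lemma activityKV a y : activity a (activity a^-1 y) = y.
Proof. by rewrite -activityM mulVg activity1. Qed.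

Lemma stateV a y : state a^-1 y = (state a (activity a^-1 y))^-1.
Proof.
apply: (mulgI (state a (activity a^-1 y))); rewrite mulgV.
by rewrite -{2}(activityKV a y) -stateM mulgV state1.
Qed.

Lemma prod_disjoint (I : eqType) (F : I -> {set 'I_m})
    (g : I -> tree_aut m) (r : seq I) :
  {in r, forall i z w, z \notin F i -> g i (z :: w) = z :: w} ->
  forall y w, (forall i, i \in r -> y \notin F i) ->
    (\prod_(i <- r) g i) (y :: w) = y :: w.
Proof.
elim: r => [|i r IH] gF y w yF; first by rewrite big_nil.
rewrite big_cons tree_autM gF ?mem_head //; last by rewrite yF ?mem_head.
apply: IH => [j jr|j jr]; first by apply: gF; rewrite inE jr orbT.
by apply: yF; rewrite inE jr orbT.
Qed.

(** Factors before [g k] fix words starting in [F k]. As [g k] keeps the first letter in [F k], the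
    factors after it fix the image as well. *)
Lemma prod_local (I : eqType) (F : I -> {set 'I_m})
    (g : I -> tree_aut m) (r : seq I) :
  uniq r ->
  {in r &, forall i j z, z \in F i -> z \in F j -> i = j} ->
  {in r, forall i z w, z \notin F i -> g i (z :: w) = z :: w} ->
  {in r, forall k y w, y \in F k -> (\prod_(i <- r) g i) (y :: w) = g k (y :: w)}.
Proof.
elim: r => [//|i r IH] /= /andP[ir ur] Fd gF k kr y w yF.
have rS j : j \in r -> j \in i :: r by rewrite inE orbC => ->.
have iS : i \in i :: r by rewrite mem_head.
rewrite big_cons tree_autM; have [Eki|ki] := eqVneq k i.
  rewrite -Eki in iS ir *; rewrite tree_aut_cons (prod_disjoint (F := F)) //.
    by move=> j jr; apply: gF; exact: rS.
  move=> j jr; apply/negP => gyF.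
  (* If the image of [y] left [F k], then [g k] would fix that image, and injectivity would make it
     equal to [y], which lies in [F k]. *)
  have gyk : activity (g k) y \in F k.
    apply: contraT => /[dup] /(gF k kr _ [::]) + nF; rewrite tree_aut_cons.
    by case=> /perm_inj gy; rewrite gy yF in nF.
  by move: ir; rewrite (Fd k j _ _ _ gyk gyF) ?jr //; exact: rS.
rewrite (gF i) //; last first.
  by apply: contra_neqN ki => yi; apply: (Fd k i kr iS y yF yi).
apply: IH => //.
- by move=> j l jr lr; apply: Fd; exact: rS.
- by move=> j jr; apply: gF; exact: rS.
- by move: kr; rewrite inE (negPf ki).
Qed.

End WreathRecursion.

(** * Self-similar groups and topological closure *)

Section SelfSimilar.
Context {m : nat}.
Implicit Types (a b : tree_aut m) (G X : set (tree_aut m)) (y z : 'I_m).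

Lemma self_similarP G :
  self_similar G <-> is_subgroup G /\ forall a y, G a -> G (state a y).
Proof.
split=> -[gG GS]; split=> // a.
  by move=> y Ga; exact: (GS a Ga _ (states_step (states_self _))).
move=> Ga b ab.
by elim: ab Ga => // {}a y {}b _ IH /(GS _ y)/IH.
Qed.

(** The members of the generated subgroup all of whose first-level states stay in it form a
    subgroup, by the formulas for states of products and inverses; it suffices to check
    generators. *)
Lemma generated_self_similar X :
  (forall a y, X a -> generated_subgroup X (state a y)) ->
  self_similar (generated_subgroup X).
Proof.
have [g1 gM gV] := generated_is_subgroup X.
move=> XS; apply/self_similarP; split=> // a y Xa; move: a Xa y.
pose G : set (tree_aut m) :=
  [set a | generated_subgroup X a /\ forall y, generated_subgroup X (state a y)].
suff GX : generated_subgroup X `<=` G by move=> a /GX [].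
apply: generated_sub => [|a Xa]; last first.
  by split=> [|y]; [apply: (sub_generated Xa) | apply: XS].
split=> [|a b [ga Sa] [gb Sb]|a [ga Sa]]; split.
- exact: g1.
- by move=> y; rewrite state1.
- exact: gM.
- by move=> y; rewrite stateM; apply: gM.
- exact: gV.
- by move=> y; rewrite stateV; apply: gV.
Qed.

(** Makes closure combinatorial: [g] agrees with [a] on level [n] exactly when [a^-1 * g] stabilizes
    that level pointwise. *)
Lemma closureP G a :
  closure G a <-> forall n, exists2 g, G g & forall w, size w = n -> g w = a w.
Proof.
split=> [cGa n|app B [n _ nB]].
  have [|g [Gg [s sn Eg]]] := cGa [set a * s | s in level_stab n].
    by exists n.
  by exists g => // w wn; rewrite -Eg tree_autM sn // size_tree_aut.
have [g Gg ga] := app n; exists g; split=> //.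
apply: nB; exists (a^-1 * g); last by rewrite mulKVg.
move=> w wn; rewrite tree_autM ga; last by rewrite size_tree_aut.
by rewrite -tree_autM mulVg.
Qed.

Lemma sub_closureP G : G `<=` closure G.
Proof. by move=> a Ga; apply/closureP => n; exists a. Qed.

Lemma closure_self_similar G : self_similar G -> self_similar (closure G).
Proof.
move=> /self_similarP[[G1 GM GV] GS]; apply/self_similarP; split; first split.
- exact: sub_closureP.
- move=> a b /closureP ca /closureP cb; apply/closureP => n.
  have [[g Gg ga] [h Gh hb]] := (ca n, cb n).
  exists (g * h) => [|w wn]; first exact: GM.
  by rewrite !tree_autM ga // hb // size_tree_aut.
- move=> a /closureP ca; apply/closureP => n; have [g Gg ga] := ca n.
  exists g^-1 => [|w wn]; first exact: GV.
  have {1}-> : w = g (a^-1 w).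
    by rewrite ga ?size_tree_aut // -tree_autM mulVg.
  by rewrite -tree_autM mulgV.
(* Level [n] below [y] sits in level [n.+1] of the whole tree. *)
- move=> a y /closureP ca; apply/closureP => n; have [g Gg ga] := ca n.+1.
  exists (state g y) => [|w wn]; first exact: GS.
  have := ga (y :: w); rewrite !tree_aut_cons /= wn => /(_ erefl).
  by case.
Qed.

(** Automorphisms preserve length, so commutation at one word [w] only involves approximants on
    level [size w]. *)
Lemma closure_abelian G : is_abelian G -> is_abelian (closure G).
Proof.
move=> cG a b /closureP ca /closureP cb; apply: tree_autP => w.
have [[g Gg ga] [h Gh hb]] := (ca (size w), cb (size w)).
rewrite !tree_autM -(ga w erefl) -(hb w erefl).
rewrite -hb ?size_tree_aut // -ga ?size_tree_aut //.
by rewrite -!tree_autM (cG g h).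
Qed.

End SelfSimilar.

(** * First-level orbits, permutation type and the group B(A) *)

Section Orbits.
Context {m : nat}.
Context (A : set (tree_aut m)).
Implicit Types (a b h : tree_aut m) (y z : 'I_m) (O : {set 'I_m}).

Definition level1_orbit y : {set 'I_m} := orbit 'P%act (activities A) y.

Lemma mem_activities (H : set (tree_aut m)) s :
  s \in activities H <-> exists2 a, H a & activity a = s.
Proof. by rewrite inE; split=> /asboolP. Qed.

Lemma level1_orbitP y z :
  z \in level1_orbit y <-> exists2 a, A a & activity a y = z.
Proof.
split=> [/imsetP[s /mem_activities[a Aa <-] ->]|[a Aa <-]]; first by exists a.
by apply/imsetP; exists (activity a) => //; apply/mem_activities; exists a.
Qed.

Lemma level1_orbit_in y : level1_orbit y \in orbits A.
Proof. by rewrite mem_undup; apply/mapP; exists y; rewrite ?mem_enum. Qed.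

Lemma orbitsP O : O \in orbits A -> exists y, O = level1_orbit y.
Proof. by rewrite mem_undup => /mapP[y _ ->]; exists y. Qed.

Lemma orbits_uniq : uniq (orbits A).
Proof. exact: undup_uniq. Qed.

Hypothesis gA : is_subgroup A.

Lemma level1_orbit_refl y : y \in level1_orbit y.
Proof. by case: gA => A1 _ _; apply/level1_orbitP; exists 1; rewrite ?activity1. Qed.

Lemma orbits_eq O y : O \in orbits A -> y \in O -> O = level1_orbit y.
Proof.
case: gA => _ AM AV /orbitsP[x ->] /level1_orbitP[a Aa <-]; apply/setP => z.
apply/idP/idP => /level1_orbitP[b Ab <-]; apply/level1_orbitP.
  by exists (a^-1 * b); [apply: AM => //; exact: AV | rewrite activityM activityV].
by exists (a * b); [exact: AM | rewrite activityM].
Qed.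

Lemma orbits_disj O O' y :
  O \in orbits A -> O' \in orbits A -> y \in O -> y \in O' -> O = O'.
Proof. by move=> OA O'A /(orbits_eq OA)-> /(orbits_eq O'A). Qed.

Lemma orbits_trans O y z : O \in orbits A -> y \in O -> z \in O ->
  exists2 a, A a & activity a y = z.
Proof. by move=> OA yO zO; apply/level1_orbitP; rewrite -(orbits_eq OA yO). Qed.

(** The first-level shadow of [locally_in]. The element [a] may change with the orbit; this much is
    enough to control the permutation type. *)
Definition acts_locally_in : set (tree_aut m) :=
  [set h | forall O, O \in orbits A ->
    exists2 a, A a & forall y, y \in O -> activity h y = activity a y].

(** This is B(A) in a product-free form, as [orbit_productE] shows; all later arguments use this
    form. *)
Definition locally_in : set (tree_aut m) :=
  [set h | forall O, O \in orbits A ->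
    exists2 a, A a & forall y w, y \in O -> h (y :: w) = a (y :: w)].

Lemma sub_locally_in : A `<=` locally_in.
Proof. by move=> a Aa O _; exists a. Qed.

Lemma locally_in_acts : locally_in `<=` acts_locally_in.
Proof.
move=> h lh O /lh[a Aa ha]; exists a => // y yO.
by have [] := (activity_state h a y y).1 (fun w => ha y w yO).
Qed.

Lemma sub_acts_locally_in : A `<=` acts_locally_in.
Proof. by move=> a /sub_locally_in/locally_in_acts. Qed.

Lemma acts_locally_in_orbit h y :
  acts_locally_in h -> activity h y \in level1_orbit y.
Proof.
move=> /(_ _ (level1_orbit_in y))[a Aa]; move/(_ y (level1_orbit_refl y)) ->.
by apply/level1_orbitP; exists a.
Qed.

Lemma acts_locally_in_mem h O y : O \in orbits A -> acts_locally_in h ->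
  (activity h y \in O) = (y \in O).
Proof.
move=> OA /(acts_locally_in_orbit y) hy.
have E : level1_orbit y = level1_orbit (activity h y).
  exact: orbits_eq (level1_orbit_in y) hy.
by apply/idP/idP => yO; rewrite (orbits_eq OA yO) ?E -?E // level1_orbit_refl.
Qed.

(** [restr_perm O] defaults to the identity on permutations that do not stabilize [O], so this fact
    is what licenses [restr_permE]. *)
Lemma activity_astabs h O : O \in orbits A -> acts_locally_in h ->
  activity h \in 'N(O | 'P).
Proof.
by move=> OA lh; apply/astabsP => y; rewrite -(acts_locally_in_mem y OA lh).
Qed.

Lemma acts_locally_in_is_subgroup : is_subgroup acts_locally_in.
Proof.
case: (gA) => A1 AM AV; split; first exact: sub_acts_locally_in.
- move=> g h lg lh O OA; have [[a Aa ga] [b Ab hb]] := (lg O OA, lh O OA).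
  exists (a * b) => [|y yO]; first exact: AM.
  by rewrite !activityM -ga // hb // (acts_locally_in_mem _ OA lg).
- move=> g lg O OA; have [a Aa ga] := lg O OA.
  exists a^-1 => [|y yO]; first exact: AV.
  rewrite -{1}(activityKV a y) -ga ?activityV //.
  rewrite -(acts_locally_in_mem _ OA (sub_acts_locally_in Aa)).
  by rewrite activityKV.
Qed.

Lemma locally_in_is_subgroup : is_subgroup locally_in.
Proof.
case: (gA) => A1 AM AV; split; first exact: sub_locally_in.
- move=> g h lg lh O OA; have [[a Aa ga] [b Ab hb]] := (lg O OA, lh O OA).
  exists (a * b) => [|y w yO]; first exact: AM.
  rewrite !tree_autM -ga // tree_aut_cons hb //.
  by rewrite (acts_locally_in_mem _ OA (locally_in_acts lg)).
- move=> g lg O OA; have [a Aa ga] := lg O OA.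
  exists a^-1 => [|y w yO]; first exact: AV.
  have Ea : y :: w = a (a^-1 (y :: w)) by rewrite -tree_autM mulVg.
  rewrite {1}Ea [a^-1 _]tree_aut_cons -ga -?tree_aut_cons -?tree_autM ?mulgV //.
  rewrite -(acts_locally_in_mem _ OA (sub_acts_locally_in Aa)).
  by rewrite activityKV.
Qed.

(** Activity is visible on level 1, so a level-1 approximant already has the right one. *)
Lemma acts_locally_in_closure (H : set (tree_aut m)) :
  H `<=` acts_locally_in -> closure H `<=` acts_locally_in.
Proof.
move=> HL h /closureP/(_ 1%N)[g /HL lg gh] O /lg[a Aa ga]; exists a => // y yO.
by rewrite -ga //; have := gh [:: y] erefl; rewrite !tree_aut_cons => -[].
Qed.

(** Common criterion for the three groups of (i): between [A] and [acts_locally_in], neither the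
    orbits nor the permutations induced on a single orbit can grow. *)
Lemma permutation_type_locally (H : set (tree_aut m)) :
  A `<=` H -> H `<=` acts_locally_in -> permutation_type H = permutation_type A.
Proof.
move=> AH HL.
have sAH s : s \in activities A -> s \in activities H.
  by move=> /mem_activities[a /AH Ha <-]; apply/mem_activities; exists a.
have EO : orbits H = orbits A.
  congr undup; apply: eq_map => y; apply/setP => z; apply/idP/idP.
    move=> /imsetP[s /mem_activities[h /HL lh <-] ->].
    exact: acts_locally_in_orbit.
  by move=> /imsetP[s /sAH sH ->]; apply/imsetP; exists s.
rewrite /permutation_type EO; apply/eq_in_map => O OA; apply/setP => t.
apply/idP/idP => /imsetP[s sH ->]; last first.
  by apply/imsetP; exists s => //; exact: sAH.
have /mem_activities[h /HL lh Eh] := sH.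
have [a Aa ha] := lh O OA; apply/imsetP; exists (activity a).
  by apply/mem_activities; exists a.
apply/permP => y; have [yO|yO] := boolP (y \in O); last first.
  by rewrite !(out_perm (restr_perm_on _ _)).
rewrite -Eh !restr_permE ?ha // activity_astabs //.
exact: sub_acts_locally_in.
Qed.

Lemma orbit_part_cons O a y w : O \in orbits A -> A a ->
  orbit_part O a (y :: w) = if y \in O then a (y :: w) else y :: w.
Proof.
move=> OA Aa; rewrite /orbit_part /=; have [yO|yO] := boolP (y \in O).
  rewrite restr_permE ?tree_aut_cons //.
  exact/activity_astabs/sub_acts_locally_in.
by rewrite (out_perm (restr_perm_on _ _)).
Qed.

(** The factors of a product in B(A) are supported on distinct orbits, so on words starting in [F i]
    only the factor of index [i] acts, and it acts there like an element of [A]. *)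
Lemma orbit_productE : orbit_product A = locally_in.
Proof.
pose r := index_enum 'I_(size (orbits A)).
pose F (i : 'I_(size (orbits A))) : {set 'I_m} := nth finset.set0 (orbits A) i.
have FA i : F i \in orbits A by exact: mem_nth.
have Fd : {in r &, forall i j z, z \in F i -> z \in F j -> i = j}.
  (* Equal orbits give equal indices because [orbits] has no repetitions. *)
  move=> i j _ _ z zi zj; apply/val_inj/eqP.
  rewrite -(nth_uniq finset.set0 (ltn_ord i) (ltn_ord j) orbits_uniq).
  by apply/eqP; exact: orbits_disj zi zj.
have prodE (f g : 'I_(size (orbits A)) -> tree_aut m) i y w :
    (forall i, A (f i)) -> (forall i, orbit_part (F i) (f i) = g i) ->
    y \in F i -> (\prod_(i <- r) g i) (y :: w) = f i (y :: w).
  move=> Af fg yF.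
  rewrite (prod_local (F := F) _ Fd _ (mem_index_enum i)) ?index_enum_uniq //.
    by rewrite -fg orbit_part_cons // yF.
  by move=> j _ z u zF; rewrite -fg orbit_part_cons // (negPf zF).
apply/seteqP; split=> [_ [g gA' <-]|h lh].
  have /choice[f fP] : forall i, exists a, A a /\ orbit_part (F i) a = g i.
    by move=> i; have [a Aa <-] := gA' i; exists a.
  move=> O OA; have Oi := OA; rewrite -index_mem in Oi.
  exists (f (Ordinal Oi)) => [|y w yO]; first by case: (fP (Ordinal Oi)).
  apply: (prodE f) => [i|i|]; [by case: (fP i) | by case: (fP i) |].
  by rewrite /F /= nth_index.
have /choice[f fP] : forall i, exists a,
    A a /\ forall y w, y \in F i -> h (y :: w) = a (y :: w).
  by move=> i; have [a Aa ha] := lh _ (FA i); exists a.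
have Af i : A (f i) by case: (fP i).
exists (fun i => orbit_part (F i) (f i)) => [i|]; first by exists (f i).
apply: tree_autP => -[|y w]; first by rewrite !tree_aut_nil.
have yA := level1_orbit_in y; have Oi := yA; rewrite -index_mem in Oi.
have yF : y \in F (Ordinal Oi) by rewrite /F /= nth_index // level1_orbit_refl.
by rewrite (prodE f _ _ _ _ Af _ yF) //; case: (fP (Ordinal Oi)) => _ ->.
Qed.

End Orbits.

(** * Partial diagonal monomorphisms and the groups Delta(H) *)

Section Diagonals.
Context {m : nat}.
Implicit Types (a b c h : tree_aut m) (y z : 'I_m) (O : {set 'I_m}).

Lemma partial_diag_cons O a y w :
  partial_diag O a (y :: w) = y :: if y \in O then a w else w.
Proof. by rewrite /partial_diag /= perm1; case: ifP. Qed.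

Lemma activity_partial_diag O a y : activity (partial_diag O a) y = y.
Proof. by have := partial_diag_cons O a y [::]; rewrite tree_aut_cons => -[]. Qed.

Lemma state_partial_diag O a y :
  state (partial_diag O a) y = if y \in O then a else 1.
Proof.
apply: tree_autP => w; have := partial_diag_cons O a y w.
by rewrite tree_aut_cons => -[_ E]; apply: (etrans E); case: ifP.
Qed.

Lemma partial_diagM O : {morph partial_diag O : a b / a * b}.
Proof.
move=> a b; apply: tree_autP => -[|y w]; first by rewrite !tree_aut_nil.
by rewrite tree_autM !partial_diag_cons; case: ifP.
Qed.

Lemma partial_diag1 O : partial_diag O 1 = 1.
Proof. by apply: (mulgI (partial_diag O 1)); rewrite -partial_diagM !mulg1. Qed.

Lemma partial_diagV O a : partial_diag O a^-1 = (partial_diag O a)^-1.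
Proof.
apply: (mulgI (partial_diag O a)).
by rewrite -partial_diagM !mulgV partial_diag1.
Qed.

(** Lists of orbits serve as words for the elements of Delta, which allows induction on length; the
    head of the list is the outermost map. *)
Definition diag_word (s : seq {set 'I_m}) a := foldr (@partial_diag m) a s.

Context (A : set (tree_aut m)).

Lemma diag_monoidP w :
  diag_monoid A w <-> exists2 s, {subset s <= orbits A} & w = diag_word s.
Proof.
split=> [Aw|[s sA ->] M [[Mid Mcomp] AM]].
  apply: (Aw [set w | exists2 s, {subset s <= orbits A} & w = diag_word s]).
  split=> [|_ [O OA <-]]; last first.
    by exists [:: O] => // O'; rewrite inE => /eqP->.
  split; first by exists [::].
  move=> _ _ [s sA ->] [t tA ->]; exists (t ++ s).
    by move=> O; rewrite mem_cat => /orP[/tA|/sA].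
  by apply: funext => a /=; rewrite /diag_word foldr_cat.
elim: s sA => [//|O s IH] sA.
apply: (Mcomp (diag_word s) (partial_diag O)).
  by apply: IH => O' O's; apply: sA; rewrite inE O's orbT.
by apply: AM; exists O => //; apply: sA; exact: mem_head.
Qed.

Lemma diag_closure_ind (H G : set (tree_aut m)) : is_subgroup G ->
  (forall s h, {subset s <= orbits A} -> H h -> G (diag_word s h)) ->
  diag_closure A H `<=` G.
Proof.
move=> gG sG; apply: generated_sub => // _ [w /diag_monoidP[s sA ->] [h Hh <-]].
exact: sG.
Qed.

Lemma diag_word_closure (H : set (tree_aut m)) s h :
  {subset s <= orbits A} -> H h -> diag_closure A H (diag_word s h).
Proof.
move=> sA Hh; apply: sub_generated.
by exists (diag_word s); [apply/diag_monoidP; exists s | exists h].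
Qed.

Lemma diag_closure_is_subgroup (H : set (tree_aut m)) :
  is_subgroup (diag_closure A H).
Proof. exact: generated_is_subgroup. Qed.

Lemma sub_diag_closure (H : set (tree_aut m)) : H `<=` diag_closure A H.
Proof. by move=> h; apply: (@diag_word_closure _ [::]). Qed.

Lemma diag_closureS (H K : set (tree_aut m)) :
  H `<=` K -> diag_closure A H `<=` diag_closure A K.
Proof.
move=> HK; apply: diag_closure_ind; first exact: diag_closure_is_subgroup.
by move=> s h sA /HK; exact: diag_word_closure.
Qed.

(** [partial_diag O] is a homomorphism, so the preimage of Delta(H) is a subgroup; it contains the
    generators since prefixing [O] to a word gives a word. *)
Lemma diag_closure_partial_diag (H : set (tree_aut m)) O h : O \in orbits A ->
  diag_closure A H h -> diag_closure A H (partial_diag O h).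
Proof.
have [D1 DM DV] := diag_closure_is_subgroup H.
move=> OA; move: h.
apply: (@diag_closure_ind _ [set h | diag_closure A H (partial_diag O h)]).
  split=> [|h k Dh Dk|h Dh] /=; first by rewrite partial_diag1.
    by rewrite partial_diagM; exact: DM.
  by rewrite partial_diagV; exact: DV.
move=> s h sA Hh; apply: (@diag_word_closure _ (O :: s)) => // O'.
by rewrite inE => /predU1P[->|/sA].
Qed.

Hypothesis gA : is_subgroup A.

(** Since [b] preserves [O], words starting off [O] avoid [c] in either order, while below [y] in
    [O] the comparison is between [c] and the state of [b]. *)
Lemma commute_partial_diag O b c : O \in orbits A -> acts_locally_in A b ->
  (forall y, y \in O -> commute c (state b y)) -> commute (partial_diag O c) b.
Proof.
move=> OA lb cb; apply: tree_autP => -[|y w]; first by rewrite !tree_aut_nil.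
rewrite !tree_autM partial_diag_cons !tree_aut_cons.
rewrite activity_partial_diag state_partial_diag (acts_locally_in_mem gA y OA lb).
by case: ifP => // /cb cby; rewrite -tree_autM cby.
Qed.

Section DiagClosure.
Context (H : set (tree_aut m)).
Hypotheses (H_ss : self_similar H) (H_ab : is_abelian H).
Hypothesis HL : H `<=` acts_locally_in A.

Lemma commute_diag_word_self s a b : {subset s <= orbits A} -> H a -> H b ->
  commute (diag_word s a) b.
Proof.
have [_ HS] := (self_similarP H).1 H_ss.
(* [b] stays general: removing the outer diagonal replaces it by one of its states, again in [H]. *)
elim: s b => [|O s IH] b sA Ha Hb; first exact: H_ab.
apply: commute_partial_diag => [||y _].
- by apply: sA; exact: mem_head.
- exact: HL.
apply: IH => // [O' O's|]; last exact: HS.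
by apply: sA; rewrite inE O's orbT.
Qed.

Lemma commute_diag_word s t a b :
  {subset s <= orbits A} -> {subset t <= orbits A} -> H a -> H b ->
  commute (diag_word s a) (diag_word t b).
Proof.
(* When both words are nonempty, the states of the second are 1 or its tail, so one letter is
   removed from each word at once. *)
move=> + + Ha Hb; elim: s t => [|O s IH] [|O' t] sA tA.
- exact: H_ab.
- exact/commute_sym/commute_diag_word_self.
- exact: commute_diag_word_self.
have OA : O \in orbits A by apply: sA; exact: mem_head.
apply: commute_partial_diag => //.
  move=> O1 _; case: gA => A1 _ _; exists 1 => // y _.
  by rewrite activity1 activity_partial_diag.
move=> y _; rewrite state_partial_diag; case: ifP => _; last exact: commute1.
by apply: IH => O1 O1s; [apply: sA | apply: tA]; rewrite inE O1s orbT.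
Qed.

Lemma diag_closure_abelian : is_abelian (diag_closure A H).
Proof.
apply: generated_abelian => _ _ [w /diag_monoidP[s sA ->] [a Ha <-]]
  [w' /diag_monoidP[t tA ->] [b Hb <-]].
exact: commute_diag_word.
Qed.

Lemma diag_closure_self_similar : self_similar (diag_closure A H).
Proof.
have [_ HS] := (self_similarP H).1 H_ss.
apply: generated_self_similar => _ y [w /diag_monoidP[s sA ->] [h Hh <-]].
rewrite -/(diag_closure A H); case: s sA => [|O s] sA.
  by apply: sub_diag_closure; exact: HS.
rewrite /= state_partial_diag; case: ifP => _.
  by apply: diag_word_closure => // O' O's; apply: sA; rewrite inE O's orbT.
by case: (diag_closure_is_subgroup H).
Qed.

Lemma diag_closure_acts_locally : diag_closure A H `<=` acts_locally_in A.
Proof.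
apply: diag_closure_ind; first exact: acts_locally_in_is_subgroup.
move=> [|O s] h sA Hh; first exact: HL.
move=> O1 _; case: gA => A1 _ _; exists 1 => // y _.
by rewrite activity1 /= activity_partial_diag.
Qed.

End DiagClosure.
End Diagonals.

(** * The centralizer of Delta(A) *)

Section TheoremA.
Context {m : nat}.
Context (A : set (tree_aut m)).
Hypotheses (A_ss : self_similar A) (A_ab : is_abelian A).

Let gA : is_subgroup A. Proof. by case: A_ss. Qed.

Lemma locally_in_self_similar : self_similar (locally_in A).
Proof.
have [_ AS] := (self_similarP A).1 A_ss.
apply/self_similarP; split; first exact: locally_in_is_subgroup.
move=> h y /(_ _ (level1_orbit_in A y))[a Aa ha].
have [_ ->] := (activity_state h a y y).1 (fun w => ha y w (level1_orbit_refl gA y)).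
by apply: sub_locally_in; exact: AS.
Qed.

(** On words starting in one orbit, [g] and [h] act as elements [a] and [b] of [A], which keep the
    first letter in that orbit. *)
Lemma locally_in_abelian : is_abelian (locally_in A).
Proof.
move=> g h lg lh; apply: tree_autP => -[|y w]; first by rewrite !tree_aut_nil.
have OA := level1_orbit_in A y; have yO := level1_orbit_refl gA y.
have [[a Aa ga] [b Ab hb]] := (lg _ OA, lh _ OA).
have stay c : A c -> activity c y \in level1_orbit A y.
  by move=> Ac; apply/level1_orbitP; exists c.
have hba : h (a (y :: w)) = b (a (y :: w)) by rewrite tree_aut_cons hb ?stay.
have gab : g (b (y :: w)) = a (b (y :: w)) by rewrite tree_aut_cons ga ?stay.
rewrite !tree_autM ga // hb // hba gab.
by have := congr1 (fun x => tfun x (y :: w)) (A_ab Aa Ab).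
Qed.

Let DA := diag_closure A A.
Let DB := diag_closure A (locally_in A).

Let DB_ab : is_abelian DB.
Proof.
apply: diag_closure_abelian => //; [exact: locally_in_self_similar | |].
  exact: locally_in_abelian.
exact: locally_in_acts.
Qed.

(** The closure of [DB] is abelian and contains [DA]. *)
Lemma closure_sub_centralizer : closure DB `<=` centralizer_of DA.
Proof.
move=> g cg h DAh; apply: (closure_abelian DB_ab) => //.
by apply: sub_closureP; exact: (diag_closureS (@sub_locally_in _ A)).
Qed.

Hypothesis A_nontrivial : A <> [set 1].

(** If [g] moved [y] out of [O], comparing states at [y] in the commutation with [partial_diag O a]
    would give [state g y = a * state g y], forcing every [a] in [A] to be 1. *)
Lemma centralizer_activity_in g O y : centralizer_of DA g -> O \in orbits A ->
  y \in O -> activity g y \in O.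
Proof.
move=> cg OA yO; apply: contraT => gyO; case: A_nontrivial.
apply/seteqP; split=> [a Aa|_ ->]; last by case: gA.
have := cg _ (diag_closure_partial_diag OA (@sub_diag_closure _ A A _ Aa)).
move=> /(congr1 (fun x => state x y)); rewrite !stateM activity_partial_diag.
rewrite !state_partial_diag (negPf gyO) yO mulg1 => E.
by apply: (mulIg (state g y)); rewrite -E mul1g.
Qed.

Lemma centralizer_acts_locally : centralizer_of DA `<=` acts_locally_in A.
Proof.
move=> g cg O OA; have [y Oy] := orbitsP OA.
have yO : y \in O by rewrite Oy level1_orbit_refl.
have [a Aa ay] := orbits_trans gA OA yO (centralizer_activity_in cg OA yO).
(* [a] matches [g] at the base point [y]; any other point is the image of [y] under some [b] in [A],
   and [b] commutes with both. *)
exists a => // z zO; have [b Ab <-] := orbits_trans gA OA yO zO.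
have gb : g * b = b * g := cg b (@sub_diag_closure _ A A _ Ab).
have ab : a * b = b * a := A_ab Aa Ab.
by rewrite -[LHS]activityM -gb activityM -ay -[LHS]activityM ab activityM.
Qed.

Lemma locally_in_match g : acts_locally_in A g ->
  exists2 b, locally_in A b & forall y, activity b y = activity g y.
Proof.
(* One element of [A] is chosen per orbit; the value 1 on other sets only makes [f] total. *)
move=> lg; have /choice[f fP] : forall O, exists a, O \in orbits A ->
    A a /\ forall y, y \in O -> activity g y = activity a y.
  move=> O; case: (boolP (O \in orbits A)) => [/lg[a Aa ga]|_].
    by exists a.
  by exists 1.
pose b := wreath (activity g) (fun y => state (f (level1_orbit A y)) y).
have bE y w : b (y :: w) = f (level1_orbit A y) (y :: w).
  have [_ fE] := fP _ (level1_orbit_in A y).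
  by rewrite [RHS]tree_aut_cons -fE // level1_orbit_refl.
exists b => [O OA|y].
  have [Af _] := fP _ OA; exists (f O) => // y w yO.
  by rewrite bE -(orbits_eq gA OA yO).
have [_ fE] := fP _ (level1_orbit_in A y).
by rewrite fE ?level1_orbit_refl //; have [] := (activity_state _ _ _ _).1 (bE y).
Qed.

(** As [g] fixes [y], its commutation with [partial_diag O h], for [O] the orbit of [y], reads at
    [y] as commutation of [state g y] with [h]. *)
Lemma centralizer_state g y : centralizer_of DA g ->
  (forall z, activity g z = z) -> centralizer_of DA (state g y).
Proof.
move=> cg g1 h Dh.
have Dxh := diag_closure_partial_diag (level1_orbit_in A y) Dh.
have := congr1 (fun x => state x y) (cg _ Dxh).
by rewrite !stateM activity_partial_diag g1 !state_partial_diag level1_orbit_refl.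
Qed.

(** With [a] in [A] sending [y] to [z], commutation at [y] gives [state g y * state a y = state a y
    * state g z]. The state of [a] is in [A], so it commutes with [state g y] and cancels. *)
Lemma centralizer_state_eq g y z : centralizer_of DA g ->
  (forall z, activity g z = z) -> z \in level1_orbit A y -> state g z = state g y.
Proof.
have [_ AS] := (self_similarP A).1 A_ss.
move=> cg g1 /level1_orbitP[a Aa <-].
have := congr1 (fun x => state x y) (cg _ (@sub_diag_closure _ A A _ Aa)).
rewrite !stateM g1 => E; apply: (mulgI (state a y)); rewrite -E.
exact (centralizer_state y cg g1 (@sub_diag_closure _ A A _ (AS a y Aa))).
Qed.

(* The witness is built as the product of the [x_i(g_i)], where [g_i]
   approximates the common state of [d] on the [i]-th orbit. *)
Lemma diagonal_approx d n : (forall y, activity d y = y) ->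
  (forall y z, z \in level1_orbit A y -> state d z = state d y) ->
  (forall y, exists2 g, DB g & forall w, size w = n -> g w = state d y w) ->
  exists2 g, DB g & forall w, size w = n.+1 -> g w = d w.
Proof.
move=> d1 dE dn; have gDB : is_subgroup DB by exact: diag_closure_is_subgroup.
have /choice[f fP] : forall O, exists g, O \in orbits A ->
    DB g /\ forall y w, y \in O -> size w = n -> g w = state d y w.
  move=> O; case: (boolP (O \in orbits A)) => [/orbitsP[y ->]|_].
    have [g Dg gd] := dn y; exists g => _; split=> // z w zO wn.
    by rewrite gd // (dE y z).
  by exists 1.
exists (\prod_(O <- orbits A) partial_diag O (f O)).
  apply: subgroup_prod => // O OA; apply: diag_closure_partial_diag => //.
  by case: (fP _ OA).
move=> [//|y w] [wn]; have OA := level1_orbit_in A y.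
have yO := level1_orbit_refl gA y; have [_ fd] := fP _ OA.
rewrite (prod_local (F := id) _ _ _ OA) ?orbits_uniq //.
- by rewrite partial_diag_cons yO (fd y) // tree_aut_cons d1.
- by move=> O O' OA' O'A z; exact: (orbits_disj gA OA' O'A).
- by move=> O _ z u zO; rewrite partial_diag_cons (negPf zO).
Qed.

Lemma centralizer_sub_closure : centralizer_of DA `<=` closure DB.
Proof.
have [_ cM cV] := centralizer_is_subgroup DA.
have [D1 DM _] := diag_closure_is_subgroup A (locally_in A).
(* Induction on the level for all [g] at once, since the hypothesis is applied to the states of
   [g * b^-1]. *)
move=> g cg; apply/closureP => n; elim: n g cg => [|n IH] g cg.
  by exists 1 => // w /size0nil->; rewrite !tree_aut_nil.
have [b Bb bg] := locally_in_match (centralizer_acts_locally cg).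
have cb : centralizer_of DA b.
  apply: closure_sub_centralizer; apply: sub_closureP.
  exact: (@sub_diag_closure _ A _ _ Bb).
have cd : centralizer_of DA (g * b^-1) by apply: cM => //; exact: cV.
have d1 y : activity (g * b^-1) y = y by rewrite activityM -bg activityV.
have [] := @diagonal_approx (g * b^-1) n d1.
- by move=> y z; exact: centralizer_state_eq.
- by move=> y; apply: IH; exact: centralizer_state.
move=> h Dh hg; exists (h * b) => [|w wn]; first by apply: DM => //; exact: (@sub_diag_closure _ A _ _ Bb).
by rewrite tree_autM hg // -tree_autM mulgKV.
Qed.

End TheoremA.

(* For A = {e}, A^* is the whole of A_m and (ii), (iii) fail, hence the
   hypothesis A <> [set 1] on these two claims. *)
Theorem theoremA (m : nat) (hm : (2 <= m)%N) (A : set (tree_aut m))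
    (A_ss : self_similar A) (A_ab : is_abelian A) :
  let DA := diag_closure A A in
  let DB := diag_closure A (orbit_product A) in
  let Astar := centralizer_of DA in
  (* (i) *)
  [/\ [/\ self_similar DA, is_abelian DA &
          permutation_type DA = permutation_type A],
      [/\ self_similar DB, is_abelian DB &
          permutation_type DB = permutation_type A] &
      [/\ self_similar (closure DB), is_abelian (closure DB) &
          permutation_type (closure DB) = permutation_type A]] /\
  (A <> [set 1] ->
    (* (ii) *) maximal_abelian_subgroup Astar /\
    (* (iii) *) Astar = closure DB).

Proof.
rewrite /= orbit_productE; last by case: A_ss.
set DA := diag_closure A A; set DB := diag_closure A (locally_in A).
have gA : is_subgroup A by case: A_ss.
have A_loc : A `<=` acts_locally_in A by exact: sub_acts_locally_in.
have B_loc : locally_in A `<=` acts_locally_in A by exact: locally_in_acts.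
have B_ss := locally_in_self_similar A_ss.
have B_ab := locally_in_abelian A_ss A_ab.
have DA_ab : is_abelian DA by exact: diag_closure_abelian.
have DB_ab : is_abelian DB by exact: diag_closure_abelian.
have DA_ss : self_similar DA by exact: diag_closure_self_similar.
have DB_ss : self_similar DB by exact: diag_closure_self_similar.
have DB_loc : DB `<=` acts_locally_in A by exact: diag_closure_acts_locally.
have ADB : A `<=` DB by move=> a /sub_locally_in; exact: sub_diag_closure.
have DAc : DA `<=` closure DB.
  move=> a DAa; apply: sub_closureP.
  exact: (diag_closureS (@sub_locally_in _ A)).
split; first (split; split).
- exact: DA_ss.
- exact: DA_ab.
- apply: permutation_type_locally => //; first exact: sub_diag_closure.
  exact: diag_closure_acts_locally.
- exact: DB_ss.
- exact: DB_ab.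
- exact: permutation_type_locally.
- exact: closure_self_similar.
- exact: closure_abelian.
- apply: permutation_type_locally => //; last exact: acts_locally_in_closure.
  by move=> a /ADB; exact: sub_closureP.
move=> A_nt; have AstarE : centralizer_of DA = closure DB.
  apply/seteqP; split; first exact: centralizer_sub_closure.
  exact: closure_sub_centralizer.
split; last exact: AstarE.
split; first exact: centralizer_is_subgroup.
  by rewrite AstarE; exact: closure_abelian.
(* An abelian [K] above the centralizer contains the closure of [DB], hence [DA], and so centralizes
   [DA]. *)
move=> K _ K_ab cK; apply/seteqP; split; last exact: cK.
move=> x Kx y DAy.
by apply: K_ab => //; apply: cK; rewrite AstarE; exact: DAc.
Qed.
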